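(* Let $G$ be a finite $\mathcal{B}$-group and let $N$ be a normal subgroup of $G$. Then the quotient $G/N$ is again a $\mathcal{B}$-group.
   Context: A generating set $X$ of a finite group $G$ is minimal if no proper subset of $X$ generates $G$. A finite group $G$ is called a $\mathcal{B}$-group (has property $\mathcal{B}$) if all its minimal generating sets have the same size. *)

(* Defs.v *)
From mathcomp Require Import all_boot all_fingroup.
Set Implicit Arguments.
Unset Strict Implicit.
Unset Printing Implicit Defensive.

Local Open Scope group_scope.

Definition min_generating_set (gT : finGroupType) (G : {group gT})
    (X : {set gT}) : bool :=
  minset [pred Y : {set gT} | <<Y>> == G] X.

Definition B_group (gT : finGroupType) (G : {group gT}) : Prop :=
  forall X Y : {set gT},
    min_generating_set G X -> min_generating_set G Y -> #|X| = #|Y|.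

(* Main.v *)
Require Import Defs.
From mathcomp Require Import all_boot all_fingroup.

(** Let [H] be a minimal supplement of [N] in [G]: a subgroup with
    [H * N = G] none of whose proper subgroups has this property.  If [Xb] is
    any generating set of [G / N], choose for each of its elements one
    preimage in [H]; the set [X] of these preimages generates a subgroup of [H]
    that still supplements [N], so it generates [H] by minimality
    ([gen_supplement_lift]).
    Now fix a subset [Z] of [N], minimal such that [H] and [Z] together
    generate [G].  Since [Z] depends on [H] only, it serves all generating sets
    of [G / N] at once: if [Xb] is a minimal generating set of [G / N], then
    the disjoint union of [X] and [Z] is a minimal generating set of [G]
    ([min_generating_set_lift]).  The union is disjoint because a minimal
    generating set does not contain [1].  An element of [X] cannot be dropped because
    its image in [G / N] is needed, and an element of [Z] cannot be dropped
    by the choice of [Z].  Hence, in a group [G] whose minimal generating sets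
    all have size [r], all those of [G / N] have size [r - #|Z|]. *)

Set Implicit Arguments.
Unset Strict Implicit.
Unset Printing Implicit Defensive.

Local Open Scope group_scope.

Lemma min_generating_setP (gT : finGroupType) (G : {group gT})
    (X : {set gT}) :
  reflect (<<X>> = G /\ forall Y : {set gT}, Y \subset X -> <<Y>> = G -> Y = X)
          (min_generating_set G X).
Proof.
apply: (iffP minsetP) => -[/= genX minX].
  by split=> [|Y sYX genY]; [apply/eqP | apply: minX => //=; apply/eqP].
by split=> [|Y /eqP genY sYX]; [apply/eqP | apply: minX].
Qed.

Lemma min_generating_set_not1 (gT : finGroupType) (G : {group gT})
    (X : {set gT}) :
  min_generating_set G X -> 1 \notin X.
Proof.
case/min_generating_setP=> genX minX; apply/negP=> X1.
have XE : X :\ 1 = X.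
  by apply: minX; rewrite ?subD1set // genD1 // group1.
by move: X1; rewrite -XE !inE eqxx.
Qed.

Section Supplement.

Variables (gT : finGroupType) (G N H : {group gT}).
Hypothesis nNG : N <| G.
Hypothesis defG : H * N = G.

Let sNG : N \subset G := normal_sub nNG.

Let sHG : H \subset G.
Proof. by rewrite -defG mulG_subl. Qed.

Let nNH : H \subset 'N(N) := subset_trans sHG (normal_norm nNG).

(** Each subset of the quotient has a set of representatives inside the
    supplement. *)
Lemma supplement_lift (Xb : {set coset_of N}) :
    Xb \subset G / N ->
  exists X : {set gT},
    [/\ X \subset H, coset N @: X = Xb & {in X &, injective (coset N)}].
Proof.
move=> sXb.
pose f (xb : coset_of N) := odflt 1 [pick h in H | coset N h == xb].
have fP xb : xb \in Xb -> f xb \in H /\ coset N (f xb) = xb.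
  rewrite /f => Xxb; case: pickP => [h /andP[Hh /eqP] // | no_h].
  have := subsetP sXb _ Xxb; rewrite -defG quotientMidr.
  case/morphimP=> h _ Hh def_xb.
  by have := no_h h; rewrite /= Hh def_xb eqxx.
exists (f @: Xb); split.
- by apply/subsetP=> _ /imsetP[xb /fP[Hf _] ->].
- rewrite -imset_comp -[RHS]imset_id.
  by apply: eq_in_imset => xb /fP[].
- move=> _ _ /imsetP[xb /fP[_ fxb] ->] /imsetP[yb /fP[_ fyb] ->].
  by rewrite fxb fyb => ->.
Qed.

Hypothesis minH :
  forall K : {group gT}, K \subset H -> K * N = G -> K :=: H.

Lemma gen_supplement_lift (X : {set gT}) :
  X \subset H -> <<coset N @: X>> = G / N -> <<X>> = H.
Proof.
move=> sXH genX; apply: minH; first by rewrite gen_subG.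
have nNX : <<X>> \subset 'N(N) by rewrite gen_subG (subset_trans sXH).
rewrite (normC nNX) -quotientK // quotient_gen ?(subset_trans sXH) //.
by rewrite /quotient morphimEsub ?(subset_trans sXH) // genX quotientGK.
Qed.

Variable Z : {set gT}.
Hypothesis sZN : Z \subset N.
Hypothesis genHZ : <<H :|: Z>> = G.
Hypothesis minZ :
  forall W : {set gT}, W \subset Z -> <<H :|: W>> = G -> W = Z.

Lemma min_generating_set_lift (Xb : {set coset_of N}) :
    min_generating_set (G / N)%G Xb ->
  exists2 X : {set gT}, min_generating_set G X & #|X| = (#|Xb| + #|Z|)%N.
Proof.
move=> mXb; have Xb1 := min_generating_set_not1 mXb.
have [/= genXb minXb] := min_generating_setP _ _ mXb.
have [|X [sXH imX injX]] := @supplement_lift Xb.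
  by rewrite -genXb subset_gen.
have genX : <<X>> = H by apply: gen_supplement_lift; rewrite ?imX.
have cosetZ z : z \in Z -> coset N z = 1.
  by move=> Zz; apply: coset_id; apply: (subsetP sZN).
have XZ0 : X :&: Z = set0.
  apply/setP=> x; rewrite !inE; apply/negP=> /andP[Xx /cosetZ x1].
  by case/negP: Xb1; rewrite -imX -x1 imset_f.
exists (X :|: Z); last first.
  by rewrite cardsU XZ0 cards0 subn0 -imX card_in_imset.
have genXU (W : {set gT}) : <<X :|: W>> = <<H :|: W>>.
  by rewrite -genX -[LHS]joingE -joing_idl.
apply/min_generating_setP; split=> [|W sW genW]; first by rewrite genXU.
have nNW : W \subset 'N(N).
  by apply: subset_trans (normal_norm nNG); rewrite -genW subset_gen.
have genWb : <<coset N @: W>> = G / N.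
  by rewrite -(morphimEsub _ nNW) -genW; apply/esym/quotient_gen.
(* Modulo [N], the elements of [Z] become trivial, so the nontrivial elements
   of the image of [W] lie in [Xb] and still generate the quotient. *)
have WbE : (coset N @: W) :\ 1 = Xb.
  apply: minXb; last by rewrite genD1 // group1.
  apply/subsetP=> xb /setD1P[w1 /imsetP[w Ww def_w]].
  move: w1; rewrite def_w -imX.
  have /setUP[Xw _ | /cosetZ->] := subsetP sW w Ww; first exact: imset_f.
  by rewrite eqxx.
have sXW : X \subset W.
  apply/subsetP=> x Xx.
  have : coset N x \in (coset N @: W) :\ 1 by rewrite WbE -imX imset_f.
  case/setD1P=> x1 /imsetP[w Ww eq_xw].
  have /setUP[Xw | /cosetZ w1] := subsetP sW w Ww.
    by rewrite (injX x w Xx Xw eq_xw).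
  by rewrite eq_xw w1 eqxx in x1.
have defW : W = X :|: (W :&: Z).
  by rewrite setUIr (setUidPr sXW); apply/esym/setIidPl.
rewrite defW; congr (_ :|: _); apply: minZ; first exact: subsetIr.
by rewrite -genXU -defW.
Qed.

End Supplement.

Lemma min_supplement_exists (gT : finGroupType) (G N : {group gT}) :
    N \subset G ->
  exists2 H : {group gT}, H * N = G
    & forall K : {group gT}, K \subset H -> K * N = G -> K :=: H.
Proof.
move=> sNG; pose P (K : {group gT}) := K * N == G.
have [|H /mingroupP[/eqP defG minH] _] := @mingroup_exists _ P G.
  by rewrite /P mulGSid.
by exists H => // K sKH defK; apply: minH => //; apply/eqP.
Qed.

Lemma min_complementary_set_exists (gT : finGroupType) (G N H : {group gT}) :
    H * N = G ->
  exists Z : {set gT}, [/\ Z \subset N, <<H :|: Z>> = G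
    & forall W : {set gT}, W \subset Z -> <<H :|: W>> = G -> W = Z].
Proof.
move=> defG; pose P (W : {set gT}) := <<H :|: W>> == G.
have [|Z /minsetP[/eqP genZ minZ] sZN] := @minset_exists _ P N.
  by rewrite /P -joingE -genM_join defG genGid.
by exists Z; split=> // W sWZ genW; apply: minZ => //; apply/eqP.
Qed.

Theorem proposition1p1 (gT : finGroupType) (G N : {group gT})
    (hG : B_group G) (hN : (N <| G)%g) : B_group (G / N)%G.
Proof.
have [H defG minH] := min_supplement_exists (normal_sub hN).
have [Z [sZN genHZ minZ]] := min_complementary_set_exists defG.
have lift := min_generating_set_lift hN defG minH sZN genHZ minZ.
move=> Xb Yb /lift[X mX cX] /lift[Y mY cY].
by apply/eqP; rewrite -(eqn_add2r #|Z|) -cX -cY (hG X Y mX mY).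
Qed.
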